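(* Let $\mathcal{H}$ be a separable Hilbert space, $I$ a countable index set, $W=\{(W_i,\omega_i)\}_{i\in I}$ a fusion frame for $\mathcal{H}$ with bounds $C_W$ and $D_W$, and $T\in B(\mathcal{H})$ an invertible operator. Write $TW=\{(TW_i,\omega_i)\}_{i\in I}$. Then the following hold: (i) If either $W_i\subset TW_i$ for all $i\in I$, or $TW_i\subset W_i$ for all $i\in I$, then $W$ and $TW$ are woven. (ii) If $W_i\subset T^*TW_i$ for all $i\in I$ and $\|I_{\mathcal{H}}-T^{-1}\|<\dfrac{C_W}{D_W}$, then $W$ and $TW$ are woven. (iii) If $T$ is a unitary operator such that $TS_\sigma-S_\sigma T$ is a positive operator for every $\sigma\subset I$, where $S_\sigma f=\sum_{i\in\sigma}\omega_i^2\pi_{W_i}f$ $(f\in\mathcal{H})$, then $W$ and $TW$ are woven.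
   Context: $\pi_V$ is the orthogonal projection onto a closed subspace $V$, $I_{\mathcal{H}}$ is the identity operator, $B(\mathcal{H})$ the bounded linear operators on $\mathcal{H}$. A family $\{(W_i,\omega_i)\}_{i\in I}$ of closed subspaces and weights $\omega_i>0$ is a fusion frame for $\mathcal{H}$ with bounds $C,D$ if $0<C\le D<\infty$ and $C\|f\|^2\le\sum_{i\in I}\omega_i^2\|\pi_{W_i}f\|^2\le D\|f\|^2$ for all $f\in\mathcal{H}$. Two fusion frames $\{(W_i,\omega_i)\}_{i\in I}$ and $\{(V_i,\nu_i)\}_{i\in I}$ are woven if there are universal constants $0<C\le D<\infty$ such that for every $\sigma\subset I$ the family $\{(W_i,\omega_i)\}_{i\in\sigma}\cup\{(V_i,\nu_i)\}_{i\in\sigma^c}$ is a fusion frame for $\mathcal{H}$ with bounds $C,D$, where $\sigma^c=I\setminus\sigma$. *)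

(* Defs.v *)
From mathcomp Require Import all_boot all_order all_algebra complex.
From mathcomp Require Import all_classical all_reals all_analysis.
From mathcomp Require Import summability.

Set Implicit Arguments.
Unset Strict Implicit.
Unset Printing Implicit Defensive.

Import Order.TTheory GRing.Theory Num.Theory.
Import numFieldNormedType.Exports.

Local Open Scope classical_set_scope.
Local Open Scope ring_scope.

(* Hilbert spaces are taken over R or over R[i]. In both cases the MathComp
   norm `|x| takes its values in the scalar field; `rnorm` below is the same
   norm seen in R, and bounds and weights are elements of R. *)
Variant scalar_kind := RealScalars | ComplexScalars.

Definition scalars (R : realType) (k : scalar_kind) : numFieldType :=
  match k with RealScalars => R | ComplexScalars => R[i] end.

Definition scalar_conj (R : realType) (k : scalar_kind) :
    scalars R k -> scalars R k :=
  match k with RealScalars => id | ComplexScalars => @conjc R end.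

Definition scalar_re (R : realType) (k : scalar_kind) : scalars R k -> R :=
  match k with RealScalars => id | ComplexScalars => @complex.Re R end.

Definition of_real (R : realType) (k : scalar_kind) : R -> scalars R k :=
  match k with RealScalars => id | ComplexScalars => fun x => (x%:C)%C end.

Definition separable (T : topologicalType) : Prop :=
  exists2 D : set T, countable D & dense D.

Definition weave (I X : Type) (sigma : set I) (a b : I -> X) : I -> X :=
  fun i => if i \in sigma then a i else b i.

Section Operators.
Variables (R : realType) (k : scalar_kind).
Variable H : completeNormedModType (scalars R k).
Implicit Types (T : H -> H) (V : set H).

Definition rnorm (x : H) : R := scalar_re `|x|.

Definition bounded_op T : Prop :=
  exists M : R, forall x, rnorm (T x) <= M * rnorm x.

Definition opnorm T : R := sup [set rnorm (T x) | x in [set x | rnorm x <= 1]].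

Definition closed_subspace V : Prop :=
  [/\ closed V, V 0 & forall (a : scalars R k) x y, V x -> V y -> V (a *: x + y)].

(* linear in the first argument, conjugate-linear in the second *)
Variable dot : {dot H for @scalar_conj R k}.

(* meaningful when V is a closed subspace *)
Definition proj V (f : H) : H :=
  get [set p | V p /\ forall v, V v -> dot (f - p) v = 0].

(* meaningful when T is linear and bounded *)
Definition adjoint T (y : H) : H :=
  get [set z | forall x, dot (T x) y = dot x z].

Definition unitary T : Prop := cancel T (adjoint T) /\ cancel (adjoint T) T.

(* Over R[i], 0 <= z says that z is real and nonnegative, so that the first
   clause is redundant; it matters only for real scalars. *)
Definition positive_op T : Prop :=
  (forall f g, dot (T f) g = dot f (T g)) /\ (forall f, 0 <= dot (T f) f).

Variable I : countType.
Implicit Types (W : I -> set H) (omega : I -> R) (sigma : set I).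

Definition fusion_frame W omega (C D : R) : Prop :=
  [/\ forall i, closed_subspace (W i), forall i, 0 < omega i, 0 < C, C <= D
    & forall f,
      ((C * rnorm f ^+ 2)%:E
         <= \esum_(i in [set: I]) (omega i ^+ 2 * rnorm (proj (W i) f) ^+ 2)%:E
         <= (D * rnorm f ^+ 2)%:E)%E].

Definition woven W omega (V : I -> set H) (nu : I -> R) : Prop :=
  exists C D : R, forall sigma : set I,
    fusion_frame (weave sigma W V) (weave sigma omega nu) C D.

(* `sum` is the limit over the net of finite subsets of I *)
Definition partial_frame_op W omega sigma (f : H) : H :=
  sum (fun i => if i \in sigma then of_real k (omega i ^+ 2) *: proj (W i) f
                else 0).

End Operators.

(* Main.v *)
Require Import Defs.
From mathcomp Require Import all_boot all_order all_algebra complex finmap.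
From mathcomp Require Import all_classical all_reals all_analysis.
From mathcomp Require Import summability.
From mathcomp Require Import ring lra.
Import Order.TTheory GRing.Theory Num.Theory.
Import numFieldNormedType.Exports.
Set Implicit Arguments.
Unset Strict Implicit.
Unset Printing Implicit Defensive.
Local Open Scope classical_set_scope.
Local Open Scope ring_scope.

(* Write P_i, Q_i for the projections onto W_i, TW_i. For every closed V,
   |P_TV f| <= |T^-1| |P_V T^* f| and |P_V T^* f| <= |T| |P_TV f|, so TW is a
   fusion frame, which bounds every weaving from above.
   (i) The smaller of the two families bounds every weaving from below.
   (ii) The inclusions force T^*T W_i = W_i, hence Q_i T = T P_i and
   |P_i f| <= |T^-1| |Q_i f| + |P_i (f - T^-1 f)|; the last terms are absorbed
   because their squares sum to at most D |I - T^-1|^2 |f|^2 with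
   |I - T^-1| < C / D <= 1.
   (iii) Positivity of T S_{i} - S_{i} T alone yields TW_i <= W_i, which is a
   case of (i). *)

(* Shadowed by the projections of product spaces in MathComp-Analysis. *)
Local Notation proj := Defs.proj.

(** * Real and complex scalars treated uniformly *)

Section Scalars.
Variables (R : realType) (k : scalar_kind).
Implicit Types (a b : R) (z w : scalars R k).

Lemma of_realK : cancel (@of_real R k) (@scalar_re R k).
Proof. by case: k. Qed.

Lemma scalar_reD z w : scalar_re (z + w) = scalar_re z + scalar_re w.
Proof. by case: k z w => // -[? ?] [? ?]. Qed.

Lemma scalar_reN z : scalar_re (- z) = - scalar_re z.
Proof. by case: k z => // -[? ?]. Qed.

Lemma scalar_re0 : scalar_re (0 : scalars R k) = 0.
Proof. by case: k. Qed.

Lemma scalar_re_real z : 0 <= z -> of_real k (scalar_re z) = z.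
Proof. by case: k z => //= -[x y]; rewrite lecE /= => /andP[/eqP ->]. Qed.

Lemma ler_of_real a b : (of_real k a <= of_real k b) = (a <= b).
Proof. by case: k => //=; exact: lecR. Qed.

Lemma ltr_of_real a b : (of_real k a < of_real k b) = (a < b).
Proof. by case: k => //=; exact: ltcR. Qed.

Lemma of_real0 : of_real k (0 : R) = 0.
Proof. by case: k. Qed.

Lemma of_realD a b : of_real k (a + b) = of_real k a + of_real k b.
Proof. by case: k => //=; exact: rmorphD. Qed.

Lemma of_realM a b : of_real k (a * b) = of_real k a * of_real k b.
Proof. by case: k => //=; exact: rmorphM. Qed.

Lemma norm_of_real a : `|of_real k a| = of_real k `|a|.
Proof.
by case: k => //=; rewrite normc_def /= expr0n addr0 sqrtr_sqr.
Qed.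

Lemma scalar_re_conj z : scalar_re (scalar_conj z) = scalar_re z.
Proof. by case: k z => // -[? ?]. Qed.

Lemma scalar_conj0 : scalar_conj (0 : scalars R k) = 0.
Proof. by case: k => //=; exact: conjc0. Qed.

Lemma scalar_conjK : involutive (@scalar_conj R k).
Proof. by case: k => //=; exact: conjcK. Qed.

Lemma scalar_re_Ml a z : scalar_re (of_real k a * z) = a * scalar_re z.
Proof. by case: k z => //= -[x y] /=; rewrite mul0r subr0. Qed.

Lemma scalar_re_ge0 z : 0 <= z -> 0 <= scalar_re z.
Proof. by move=> z0; rewrite -ler_of_real of_real0 scalar_re_real. Qed.

(** The product is |z|^2; a one-sided bound on a real part thus yields a scalar identity. *)
Lemma mul_conj_le0 z : scalar_re (scalar_conj z * z) <= 0 -> z = 0.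
Proof.
case: k z => /= [z|[x y] /= h].
  by rewrite -expr2 => z0; apply/eqP; rewrite -sqrf_eq0 eq_le z0 sqr_ge0.
have xy : x ^+ 2 + y ^+ 2 == 0.
  rewrite eq_le addr_ge0 ?sqr_ge0// andbT.
  by apply: le_trans h; rewrite le_eqVlt; apply/orP; left; apply/eqP; ring.
move: xy; rewrite paddr_eq0 ?sqr_ge0// !sqrf_eq0 => /andP[/eqP -> /eqP ->].
by [].
Qed.

End Scalars.

(** * The real-valued norm and the real part of the inner product *)

Section Inner.
Variables (R : realType) (k : scalar_kind).
Variable H : completeNormedModType (scalars R k).
Implicit Types (x y z : H) (a : R).

Lemma normE x : `|x| = of_real k (rnorm x).
Proof. by rewrite scalar_re_real. Qed.

Lemma rnorm_ge0 x : 0 <= rnorm x.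
Proof. by rewrite -(ler_of_real k) -normE of_real0. Qed.

Lemma rnormD x y : rnorm (x + y) <= rnorm x + rnorm y.
Proof. by rewrite -(ler_of_real k) of_realD -!normE ler_normD. Qed.

Lemma rnorm0 : rnorm (0 : H) = 0.
Proof. by rewrite /rnorm normr0 scalar_re0. Qed.

Lemma rnorm_eq0 x : rnorm x = 0 -> x = 0.
Proof. by move=> x0; apply/normr0_eq0; rewrite normE x0 of_real0. Qed.

Lemma rnormZ a x : rnorm (of_real k a *: x) = `|a| * rnorm x.
Proof. by rewrite /rnorm normrZ norm_of_real scalar_re_Ml. Qed.

Lemma rnorm_scale (c : scalars R k) x :
  rnorm (c *: x) = scalar_re `|c| * rnorm x.
Proof.
by rewrite /rnorm normrZ -(scalar_re_real (normr_ge0 c)) scalar_re_Ml of_realK.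
Qed.

Lemma rnormB x y : rnorm (x - y) = rnorm (y - x).
Proof. by rewrite /rnorm distrC. Qed.

Variable dot : {dot H for @scalar_conj R k}.

Definition re_dot x y : R := scalar_re (dot x y).

Lemma dotC x y : dot x y = scalar_conj (dot y x).
Proof. by have := @hermitian_subproof _ _ _ _ dot x y; rewrite expr0 mul1r. Qed.

Lemma dotDl x y z : dot (x + y) z = dot x z + dot y z.
Proof. exact: linearDl. Qed.

Lemma dotBl x y z : dot (x - y) z = dot x z - dot y z.
Proof. exact: linearBl. Qed.

Lemma dotZl c x y : dot (c *: x) y = c * dot x y.
Proof. exact: linearZl_LR. Qed.

Lemma dotZr c x y : dot x (c *: y) = scalar_conj c * dot x y.
Proof. exact: (@linearZr_LR _ _ _ _ _ _ dot). Qed.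

Lemma rdotC x y : re_dot x y = re_dot y x.
Proof. by rewrite /re_dot dotC scalar_re_conj. Qed.

Lemma rdotDl x y z : re_dot (x + y) z = re_dot x z + re_dot y z.
Proof. by rewrite /re_dot dotDl scalar_reD. Qed.

Lemma rdotNl x z : re_dot (- x) z = - re_dot x z.
Proof. by rewrite /re_dot linearNl scalar_reN. Qed.

Lemma rdotBl x y z : re_dot (x - y) z = re_dot x z - re_dot y z.
Proof. by rewrite rdotDl rdotNl. Qed.

Lemma rdotDr x y z : re_dot z (x + y) = re_dot z x + re_dot z y.
Proof. by rewrite rdotC rdotDl !(rdotC z). Qed.

Lemma rdotBr x y z : re_dot z (x - y) = re_dot z x - re_dot z y.
Proof. by rewrite rdotC rdotBl !(rdotC z). Qed.

Lemma rdotZl a x y : re_dot (of_real k a *: x) y = a * re_dot x y.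
Proof. by rewrite /re_dot dotZl scalar_re_Ml. Qed.

Lemma rdotZr a x y : re_dot x (of_real k a *: y) = a * re_dot x y.
Proof. by rewrite rdotC rdotZl rdotC. Qed.

Hypothesis norm_dot : forall x : H, `|x| ^+ 2 = dot x x.

Lemma rdotxx x : re_dot x x = rnorm x ^+ 2.
Proof. by rewrite /re_dot -norm_dot normE !expr2 -of_realM of_realK. Qed.

Lemma rdot_le x y : re_dot x y <= rnorm x * rnorm y.
Proof.
have [y0|y0] := eqVneq (rnorm y) 0.
  by rewrite (rnorm_eq0 y0) rnorm0 mulr0 /re_dot linear0r scalar_re0.
have [x0|x0] := eqVneq (rnorm x) 0.
  by rewrite (rnorm_eq0 x0) rnorm0 mul0r /re_dot linear0l scalar_re0.
have nx : 0 < rnorm x by rewrite lt_neqAle eq_sym x0 rnorm_ge0.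
have ny : 0 < rnorm y by rewrite lt_neqAle eq_sym y0 rnorm_ge0.
(* Cauchy-Schwarz: |u|^2 = 2 |x| |y| (|x| |y| - Re <x, y>), with both norms nonzero. *)
pose u := of_real k (rnorm y) *: x - of_real k (rnorm x) *: y.
have : 0 <= re_dot u u by rewrite rdotxx sqr_ge0.
rewrite rdotBl !rdotBr !rdotZl !rdotZr !rdotxx (rdotC y x).
move=> h.
have : 0 <= (2 * rnorm x * rnorm y) * (rnorm x * rnorm y - re_dot x y).
  by apply: le_trans h _; rewrite le_eqVlt; apply/orP; left; apply/eqP; ring.
by rewrite pmulr_rge0 ?subr_ge0// !mulr_gt0.
Qed.

End Inner.

(** A quadratic in t that vanishes at 0 and stays nonnegative has derivative 0 there. The
    variational arguments below rest on this. *)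
Lemma linear_term_eq0 (R : realFieldType) (c q : R) :
  0 <= q -> (forall t, 0 <= 2 * t * c + t ^+ 2 * q) -> c = 0.
Proof.
move=> q0 h; have q1 : 0 < q + 1 by lra.
(* The minimiser would be -c / q; the shift by 1 allows q = 0 and still gives a negative value
   unless c = 0. *)
have := h (- c / (q + 1)).
have -> : 2 * (- c / (q + 1)) * c + (- c / (q + 1)) ^+ 2 * q
  = - (c / (q + 1)) ^+ 2 * (q + 2) by field; rewrite gt_eqF.
rewrite mulNr oppr_ge0 => h'.
have : (c / (q + 1)) ^+ 2 * (q + 2) == 0.
  by rewrite eq_le h' mulr_ge0 ?sqr_ge0 //; lra.
rewrite mulf_eq0 sqrf_eq0 mulf_eq0 invr_eq0 !(gt_eqF q1) orbF.
by case/orP => /eqP // ?; lra.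
Qed.

(** * Closed subspaces and their orthogonal projections *)

Section Projection.
Variables (R : realType) (k : scalar_kind).
Variable H : completeNormedModType (scalars R k).
Implicit Types (x y z f g : H) (a e : R) (V : set H).

(** Radii of balls lie in the scalar field, but a positive scalar is real, so real radii suffice. *)
Lemma nbhs_rnorm x (A : set H) :
  nbhs x A <-> exists2 e : R, 0 < e & forall y, rnorm (x - y) < e -> A y.
Proof.
split=> [/nbhs_normP[e /= e0 eA]|[e e0 eA]].
  exists (scalar_re e).
    by rewrite -(ltr_of_real k) of_real0 scalar_re_real // ltW.
  move=> y xy; have := eA y; rewrite /= normE -(scalar_re_real (ltW e0)).
  by rewrite ltr_of_real; apply.
apply/nbhs_normP; exists (of_real k e) => /=.
  by rewrite -(of_real0 R k) ltr_of_real.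
by move=> y /=; rewrite normE ltr_of_real => /eA.
Qed.

Lemma closed_rnorm V : closed V <->
  forall x, (forall e, 0 < e -> exists2 v, V v & rnorm (x - v) < e) -> V x.
Proof.
split=> [/closure_id Vcl x h|h].
  rewrite Vcl => A /nbhs_rnorm[e e0 eA].
  by have [v Vv xv] := h _ e0; exists v; split => //; exact: eA.
apply/closure_id; rewrite eqEsubset; split; first exact: subset_closure.
move=> x clx; apply: h => e e0.
have /clx [v [Vv xv]] : nbhs x [set y | rnorm (x - y) < e].
  by apply/nbhs_rnorm; exists e.
by exists v.
Qed.

Lemma complete_rnorm (u : nat -> H) :
    (forall e, 0 < e ->
      exists N, forall m n, (N <= m)%N -> (N <= n)%N ->
        rnorm (u m - u n) < e) ->
  exists l, forall e, 0 < e ->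
    exists N, forall n, (N <= n)%N -> rnorm (l - u n) < e.
Proof.
move=> cu.
have /cauchy_cvgP : cauchy (u @ \oo).
  apply/cauchy_exP => e e0.
  have re0 : 0 < scalar_re e.
    by rewrite -(ltr_of_real k) of_real0 scalar_re_real // ltW.
  have [N hN] := cu _ re0.
  exists (u N); exists N => // n /= Nn.
  rewrite -ball_normE /ball_ /= normE -(scalar_re_real (ltW e0)) ltr_of_real.
  exact: hN.
move=> /cvg_ex[l ul]; exists l => e e0.
have /ul [N _ hN] : nbhs l [set y | rnorm (l - y) < e].
  by apply/nbhs_rnorm; exists e.
by exists N.
Qed.

Variable dot : {dot H for @scalar_conj R k}.
Hypothesis norm_dot : forall x : H, `|x| ^+ 2 = dot x x.

Local Notation rdot := (re_dot dot).

Lemma closed_subspaceD V x y : closed_subspace V -> V x -> V y -> V (x + y).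
Proof. by case=> _ _ VP Vx Vy; rewrite -[x]scale1r; apply: VP. Qed.

Lemma closed_subspaceZ V c x : closed_subspace V -> V x -> V (c *: x).
Proof. by case=> _ V0 VP Vx; rewrite -[_ *: x]addr0; apply: VP. Qed.

Lemma closed_subspaceB V x y : closed_subspace V -> V x -> V y -> V (x - y).
Proof.
move=> Vc Vx Vy; apply: closed_subspaceD => //.
by rewrite -scaleN1r; apply: closed_subspaceZ.
Qed.

(** The parallelogram law for f - x and f - y, arranged around the midpoint of x and y as
    [ex_nearest] needs it. *)
Lemma parallelogram f x y : rnorm (x - y) ^+ 2 =
  2 * rnorm (f - x) ^+ 2 + 2 * rnorm (f - y) ^+ 2
  - 4 * rnorm (f - of_real k 2^-1 *: (x + y)) ^+ 2.
Proof.
rewrite -!(rdotxx norm_dot) !(rdotBl, rdotBr, rdotZl, rdotZr, rdotDl, rdotDr).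
by rewrite !(rdotC dot _ f) (rdotC dot y x); field.
Qed.

(** A minimising sequence is Cauchy because midpoints stay in V, hence at least the infimum away
    from f; completeness and closedness then give a limit in V. *)
Lemma ex_nearest V f : closed_subspace V ->
  exists2 p, V p & forall v, V v -> rnorm (f - p) <= rnorm (f - v).
Proof.
move=> Vc; have [Vcl V0 _] := Vc.
pose D : set R := [set rnorm (f - v) | v in V].
have Dinf : has_inf D.
  split; first by exists (rnorm (f - 0)); exists 0.
  by exists 0 => _ [v _ <-]; apply: rnorm_ge0.
pose s := inf D.
have sle v : V v -> s <= rnorm (f - v).
  by move=> Vv; apply: ge_inf; [exact: Dinf.2 | exists v].
have s0 : 0 <= s.
  by apply: lb_le_inf; [exact: Dinf.1 | move=> _ [v _ <-]; apply: rnorm_ge0].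
have /choice[u uP] : forall n : nat,
    exists v, V v /\ rnorm (f - v) < s + n.+1%:R^-1.
  move=> n; have n0 : 0 < n.+1%:R^-1 :> R by [].
  have [_ [v Vv <-] ltv] := inf_adherent n0 Dinf.
  by exists v.
have uV n : V (u n) by have [] := uP n.
have small e : 0 < e -> exists N, forall n, (N <= n)%N -> (n.+1%:R^-1 : R) < e.
  move=> e0; exists (Num.truncn e^-1) => n Nn.
  rewrite invf_plt ?posrE//.
  by apply: lt_le_trans (truncnS_gt _) _; rewrite ler_nat.
have [|p up] := @complete_rnorm u.
  move=> e e0.
  (* Both distances to f are at most s + d and the midpoint is at least s away, so |u_m - u_n|^2 <=
     4 (s + d)^2 - 4 s^2 = d (8 s + 4 d), which is below d (8 s + 8) because d <= 1. *)
  pose d := Num.min 1 (e ^+ 2 / (8 * s + 8)).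
  have s8 : 0 < 8 * s + 8 by lra.
  have d0 : 0 < d by rewrite lt_min ltr01 divr_gt0 ?exprn_gt0.
  have d1 : d <= 1 by rewrite ge_min lexx.
  have de : d * (8 * s + 8) <= e ^+ 2.
    by rewrite -ler_pdivlMr// ge_min lexx orbT.
  have [N hN] := small d d0; exists N => m n Nm Nn.
  rewrite -(@ltr_pXn2r _ 2) ?nnegrE ?rnorm_ge0 ?ltW// ?(ltW e0)//.
  rewrite (parallelogram f).
  have := sle _ (closed_subspaceZ (of_real k 2^-1) Vc
                  (closed_subspaceD Vc (uV m) (uV n))).
  set z := rnorm _ => sz.
  have [_ um] := uP m; have [_ un] := uP n.
  have := hN m Nm; have := hN n Nn => hn hm.
  have am : rnorm (f - u m) <= s + d by apply/ltW/(lt_trans um); rewrite ltrD2l.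
  have an : rnorm (f - u n) <= s + d by apply/ltW/(lt_trans un); rewrite ltrD2l.
  have nm := rnorm_ge0 (f - u m); have nn := rnorm_ge0 (f - u n).
  nra.
exists p.
  apply: (closed_rnorm V).1 => // e e0; have [N hN] := up e e0.
  by exists (u N) => //; exact: hN.
move=> v /sle; apply: le_trans; apply/ler_addgt0Pr => e e0.
have [N hN] := up _ (divr_gt0 e0 (ltr0n _ 2)).
have [M hM] := small _ (divr_gt0 e0 (ltr0n _ 2)).
have -> : f - p = (f - u (maxn N M)) + (u (maxn N M) - p).
  by rewrite addrA subrK.
apply: le_trans (rnormD _ _) _; rewrite (rnormB _ p).
have [_ ] := uP (maxn N M).
have := hN _ (leq_maxl N M); have := hM _ (leq_maxr N M).
by move: (_^-1 : R) => ?; move=> *; lra.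
Qed.

(** Testing against [dot x v *: v], still in V, makes the real part equal to |<x, v>|^2. *)
Lemma rdot_eq0 V x : closed_subspace V ->
  (forall v, V v -> rdot x v = 0) -> forall v, V v -> dot x v = 0.
Proof.
move=> Vc h v Vv; apply: mul_conj_le0.
by rewrite -dotZr [X in X <= 0]h//; apply: closed_subspaceZ.
Qed.

(** Justifies the [get] in [proj]: for the nearest point p and v in V, |f - p - t v|^2 is minimal at
    t = 0, so its linear term, a multiple of Re <f - p, v>, vanishes. *)
Lemma projP V f : closed_subspace V ->
  V (proj dot V f) /\ forall v, V v -> dot (f - proj dot V f) v = 0.
Proof.
move=> Vc.
suff /getPex : exists p, [set p | V p /\ forall v, V v -> dot (f - p) v = 0] p.
  by [].
have [p Vp pmin] := ex_nearest f Vc.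
exists p; split=> //; apply: (rdot_eq0 Vc) => v Vv.
apply/oppr_inj; rewrite oppr0.
apply: (@linear_term_eq0 _ _ (rnorm v ^+ 2)) => [|t]; first exact: sqr_ge0.
have := pmin _ (closed_subspaceD Vc Vp (closed_subspaceZ (of_real k t) Vc Vv)).
rewrite -(@ler_pXn2r _ 2) ?nnegrE ?rnorm_ge0// opprD addrA.
move: (f - p) => g.
have -> : rnorm (g - of_real k t *: v) ^+ 2
    = rnorm g ^+ 2 - 2 * t * rdot g v + t ^+ 2 * rnorm v ^+ 2.
  rewrite -!(rdotxx norm_dot) rdotBl !rdotBr !rdotZl !rdotZr (rdotC dot v g).
  by ring.
by rewrite /re_dot; lra.
Qed.

Lemma proj_in V f : closed_subspace V -> V (proj dot V f).
Proof. by case/(projP f). Qed.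

Lemma proj_unique V f p : closed_subspace V ->
  V p -> (forall v, V v -> dot (f - p) v = 0) -> proj dot V f = p.
Proof.
move=> Vc Vp pP; have [Vq qP] := projP f Vc.
apply/subr0_eq/rnorm_eq0/eqP; rewrite -sqrf_eq0 -(rdotxx norm_dot); apply/eqP.
set q := proj dot V f in Vq qP *.
(* q - p is a difference of two vectors orthogonal to V, tested against a vector of V. *)
have Vqp : V (q - p) by exact: closed_subspaceB.
have -> : rdot (q - p) (q - p) = rdot (f - p) (q - p) - rdot (f - q) (q - p).
  by rewrite -rdotBl; congr (rdot _ _); rewrite opprB [RHS]addrC addrA subrK.
by rewrite /re_dot (pP _ Vqp) (qP _ Vqp) scalar_re0 subrr.
Qed.

Lemma proj_id V f : closed_subspace V -> V f -> proj dot V f = f.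
Proof.
by move=> Vc Vf; apply: proj_unique => // v _; rewrite subrr linear0l.
Qed.

Lemma projD V f g : closed_subspace V ->
  proj dot V (f + g) = proj dot V f + proj dot V g.
Proof.
move=> Vc; have [Vf fP] := projP f Vc; have [Vg gP] := projP g Vc.
apply: (proj_unique Vc) => [|v Vv]; first exact: closed_subspaceD.
by rewrite opprD addrACA dotDl fP// gP// addr0.
Qed.

Lemma rdot_proj V f v : closed_subspace V -> V v ->
  rdot (proj dot V f) v = rdot f v.
Proof.
move=> Vc Vv; apply/esym/eqP; rewrite -subr_eq0 -rdotBl /re_dot.
by have [_ ->] := projP f Vc; rewrite ?scalar_re0.
Qed.

End Projection.

(** * Adjoints of bounded operators *)

Section Adjoint.
Variables (R : realType) (k : scalar_kind).
Variable H : completeNormedModType (scalars R k).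
Variable dot : {dot H for @scalar_conj R k}.
Hypothesis norm_dot : forall x : H, `|x| ^+ 2 = dot x x.
Implicit Types (x y z f : H) (V : set H).

Local Notation rdot := (re_dot dot).

(** * The Riesz representation theorem *)

Section Riesz.
Variables (phi : H -> scalars R k) (M : R).
Hypothesis phi_linear : forall c x y, phi (c *: x + y) = c * phi x + phi y.
Hypothesis phi_bounded : forall x, scalar_re (phi x) <= M * rnorm x.

Let phi0 : phi 0 = 0.
Proof.
apply: (@addIr _ (phi 0)).
by have := phi_linear 1 0 0; rewrite mul1r scale1r addr0 add0r => <-.
Qed.

Let phiZ c x : phi (c *: x) = c * phi x.
Proof. by have := phi_linear c x 0; rewrite phi0 !addr0. Qed.

Let phiB x y : phi (x - y) = phi x - phi y.
Proof. by rewrite addrC -scaleN1r phi_linear mulN1r addrC. Qed.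

Lemma kernel_closed_subspace : closed_subspace [set x | phi x = 0].
Proof.
split=> [||c x y /= x0 y0]; last by rewrite phi_linear x0 y0 mulr0 addr0.
  2: exact: phi0.
apply/closed_rnorm => x xcl /=; apply: mul_conj_le0.
(* For v in the kernel, |phi x|^2 is the real part of phi (c (x - v)), at most K |x - v|; such v
   exist arbitrarily close to x. *)
set c := scalar_conj _; apply/ler_addgt0Pr => e e0; rewrite add0r.
pose K := `|M| * scalar_re `|c|.
have K0 : 0 <= K by rewrite mulr_ge0// scalar_re_ge0.
have K1 : 0 < K + 1 by lra.
have [v v0 xv] := xcl _ (divr_gt0 e0 K1).
rewrite -[phi x]subr0 -v0 -phiB -phiZ.
apply: le_trans (phi_bounded _) _; rewrite rnorm_scale mulrA.
have Kle : M * scalar_re `|c| <= K.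
  by rewrite ler_wpM2r ?scalar_re_ge0 ?ler_norm.
apply: le_trans (ler_wpM2r (rnorm_ge0 _) Kle) _.
apply: le_trans (ler_wpM2l K0 (ltW xv)) _.
by rewrite mulrA ler_pdivrMr// mulrC ler_wpM2l ?(ltW e0)//; lra.
Qed.

Lemma riesz_representation : exists z, forall x, phi x = dot x z.
Proof.
have [phi_eq0|] := pselect (forall x, phi x = 0).
  by exists 0 => x; rewrite linear0r phi_eq0.
move=> /existsNP[u /eqP phiu].
have Kc := kernel_closed_subspace.
pose n := u - proj dot [set x | phi x = 0] u.
have phin : phi n != 0.
  by rewrite /n phiB (proj_in norm_dot u Kc : phi _ = 0) subr0.
have nn : dot n n != 0.
  rewrite -norm_dot sqrf_eq0 normr_eq0; apply: contraNneq phin => ->.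
  by rewrite phi0.
(* n is orthogonal to the kernel, which contains x - (phi x / phi n) n, so <x, n> = (phi x / phi n)
   <n, n>. The conjugate compensates the conjugate-linear second argument. *)
exists (scalar_conj (phi n / dot n n) *: n) => x.
have [_ /(_ (x - (phi x / phi n) *: n))] := projP norm_dot u Kc.
rewrite -/n /= phiB phiZ divfK// subrr => /(_ erefl).
move=> /(congr1 (@scalar_conj R k)).
rewrite -dotC scalar_conj0 dotBl dotZl dotZr scalar_conjK => /eqP.
rewrite subr_eq0 => /eqP ->.
by rewrite mulrC -mulrA (mulrCA (dot n n)) divff ?nn// mulr1 divfK.
Qed.

End Riesz.

Variable T : {linear H -> H}.
Hypothesis T_bounded : bounded_op T.

(** Justifies the [get] in [adjoint]: by Cauchy-Schwarz x |-> <T x, y> is a bounded functional,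
    which Riesz represents. *)
Lemma dot_adjoint x y : dot (T x) y = dot x (adjoint dot T y).
Proof.
suff /getPex : exists z, [set z | forall x, dot (T x) y = dot x z] z by [].
have [M MP] := T_bounded.
apply: (@riesz_representation _ (M * rnorm y)) => [c u v|u].
  by rewrite linearP dotDl dotZl.
apply: le_trans (rdot_le norm_dot _ _) _; rewrite mulrAC.
by apply: ler_wpM2r (MP u); exact: rnorm_ge0.
Qed.

Lemma rdot_adjoint x y : rdot (T x) y = rdot x (adjoint dot T y).
Proof. by rewrite /re_dot dot_adjoint. Qed.

(** * Estimates for an invertible operator and the images of subspaces *)

Variables (Tinv : {linear H -> H}) (a b : R).
Hypotheses (a0 : 0 < a) (b0 : 0 < b).
Hypotheses (T_le : forall x, rnorm (T x) <= b * rnorm x).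
Hypotheses (Tinv_le : forall x, rnorm (Tinv x) <= a * rnorm x).
Hypotheses (TK : cancel T Tinv) (TinvK : cancel Tinv T).

(** Closedness: TV is the preimage of V under the Lipschitz map [Tinv]. *)
Lemma image_closed_subspace V : closed_subspace V -> closed_subspace (T @` V).
Proof.
move=> [Vcl V0 VP]; split=> [||c _ _ [x Vx <-] [y Vy <-]].
- apply/closed_rnorm => x xcl; exists (Tinv x); last exact: TinvK.
  apply: (closed_rnorm V).1 => // e e0.
  have [_ [v Vv <-] xv] := xcl _ (divr_gt0 e0 a0).
  exists v => //; rewrite -[v]TK -linearB; apply: le_lt_trans (Tinv_le _) _.
  by rewrite mulrC -ltr_pdivlMr.
- by exists 0 => //; rewrite linear0.
- by exists (c *: x + y); [exact: VP|rewrite linearP].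
Qed.

(** Cancels a factor s without splitting off s = 0; the norm bounds below arise as |p|^2 = Re <p, g>
    <= t |p|. *)
Lemma le_of_sqr_le (s t : R) : 0 <= t -> s ^+ 2 <= t * s -> s <= t.
Proof.
move=> t0 h; rewrite leNgt; apply/negP => ts.
by move: h; rewrite expr2 leNgt ltr_pM2r ?ts// (le_lt_trans t0).
Qed.

(** Write p = P_TV f as T v with v in V: |p|^2 = Re <f, T v> = Re <P_V T^* f, v>, and |v| = |T^-1 p|
    <= a |p|. *)
Lemma rnorm_proj_image_le V f : closed_subspace V ->
  rnorm (proj dot (T @` V) f) <= a * rnorm (proj dot V (adjoint dot T f)).
Proof.
move=> Vc; have TVc := image_closed_subspace Vc.
have TVp := proj_in norm_dot f TVc; set p := proj dot (T @` V) f in TVp *.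
have [v Vv vp] := TVp.
apply: le_of_sqr_le; first by rewrite mulr_ge0 ?rnorm_ge0// ltW.
rewrite -(rdotxx norm_dot) (rdot_proj norm_dot f TVc TVp) -vp.
rewrite rdotC rdot_adjoint rdotC -(rdot_proj norm_dot _ Vc Vv).
apply: le_trans (rdot_le norm_dot _ _) _.
rewrite mulrAC [leRHS]mulrC ler_wpM2l ?rnorm_ge0//.
by rewrite -[leLHS]/(rnorm v) -{1}[v]TK.
Qed.

(** With q = P_V T^* f, |q|^2 = Re <f, T q> = Re <P_TV f, T q>, and |T q| <= b |q|. *)
Lemma rnorm_proj_adjoint_le V f : closed_subspace V ->
  rnorm (proj dot V (adjoint dot T f)) <= b * rnorm (proj dot (T @` V) f).
Proof.
move=> Vc; have TVc := image_closed_subspace Vc.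
have Vq := proj_in norm_dot (adjoint dot T f) Vc.
set q := proj dot V _ in Vq *.
apply: le_of_sqr_le; first by rewrite mulr_ge0 ?rnorm_ge0// ltW.
rewrite -(rdotxx norm_dot) (rdot_proj norm_dot _ Vc Vq) rdotC -rdot_adjoint.
have TVq : (T @` V) (T q) by exists q.
rewrite rdotC -(rdot_proj norm_dot f TVc TVq).
apply: le_trans (rdot_le norm_dot _ _) _.
by rewrite mulrAC [leRHS]mulrC ler_wpM2l ?rnorm_ge0.
Qed.

Lemma rnorm_adjoint_le f : rnorm (adjoint dot T f) <= b * rnorm f.
Proof.
apply: le_of_sqr_le; first by rewrite mulr_ge0 ?rnorm_ge0// ltW.
rewrite -(rdotxx norm_dot) -rdot_adjoint.
apply: le_trans (rdot_le norm_dot _ _) _.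
by rewrite mulrAC ler_wpM2r ?rnorm_ge0.
Qed.

(** |f|^2 = Re <T T^-1 f, f> = Re <T^-1 f, T^* f>. *)
Lemma rnorm_le_adjoint f : rnorm f <= a * rnorm (adjoint dot T f).
Proof.
apply: le_of_sqr_le; first by rewrite mulr_ge0 ?rnorm_ge0// ltW.
rewrite -(rdotxx norm_dot) -{1}[f]TinvK rdot_adjoint.
apply: le_trans (rdot_le norm_dot _ _) _.
by rewrite mulrAC ler_wpM2r ?rnorm_ge0.
Qed.

(* Split T*Tv as p + q along V + V^perp; p = T*Tu for some u in V, hence
   q = T*T(v - u) is orthogonal to v - u and |T(v - u)|^2 = 0. *)
Lemma adjoint_comp_stable V v : closed_subspace V ->
  V `<=` [set adjoint dot T (T w) | w in V] -> V v -> V (adjoint dot T (T v)).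
Proof.
move=> Vc VA Vv; have [Vp pP] := projP norm_dot (adjoint dot T (T v)) Vc.
have [u Vu up] := VA _ Vp.
suff -> : v = u by rewrite up.
have Vvu : V (v - u) by exact: closed_subspaceB.
apply/subr0_eq/(can_inj TK); rewrite linear0; apply/rnorm_eq0/eqP.
rewrite -sqrf_eq0 -(rdotxx norm_dot) {2}linearB rdotBr !rdot_adjoint.
by rewrite -rdotBr up rdotC /re_dot pP// scalar_re0.
Qed.

(** f - T P_V T^-1 f = T g with g = T^-1 f - P_V T^-1 f orthogonal to V; pairing it with T v gives
    <g, T^*T v>, which vanishes as T^*T v is in V. *)
Lemma proj_image V f : closed_subspace V ->
    V `<=` [set adjoint dot T (T w) | w in V] ->
  proj dot (T @` V) f = T (proj dot V (Tinv f)).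
Proof.
move=> Vc VA; have [Vp pP] := projP norm_dot (Tinv f) Vc.
apply: (proj_unique norm_dot); first exact: image_closed_subspace.
  by exists (proj dot V (Tinv f)).
move=> _ [v Vv <-]; rewrite -{1}[f]TinvK -linearB dot_adjoint.
exact: pP (adjoint_comp_stable Vc VA Vv).
Qed.

(** |P_1 f|^2 = Re <f, P_1 f> = Re <P_2 f, P_1 f>, because P_1 f lies in V2 too. *)
Lemma le_rnorm_proj V1 V2 f : closed_subspace V1 -> closed_subspace V2 ->
  V1 `<=` V2 -> rnorm (proj dot V1 f) <= rnorm (proj dot V2 f).
Proof.
move=> V1c V2c V12; have Vp := proj_in norm_dot f V1c.
apply: le_of_sqr_le; first exact: rnorm_ge0.
rewrite -(rdotxx norm_dot) {1}(rdot_proj norm_dot _ V1c Vp).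
by rewrite -(rdot_proj norm_dot f V2c (V12 _ Vp)) (rdot_le norm_dot).
Qed.

End Adjoint.

(** * Vectors annihilated by a positive operator *)

Section PositiveOperator.
Variables (R : realType) (k : scalar_kind).
Variable H : completeNormedModType (scalars R k).
Variable dot : {dot H for @scalar_conj R k}.
Hypothesis norm_dot : forall x : H, `|x| ^+ 2 = dot x x.

(** Re <B (f + t B f), f + t B f> is a nonnegative quadratic in t with zero constant term and linear
    coefficient 2 |B f|^2. *)
Lemma positive_op_eq0 (B : H -> H) f :
  positive_op dot B -> dot (B f) f = 0 -> B f = 0.
Proof.
move=> [Bsym Bpos] Bff.
have rBsym x y : re_dot dot (B x) y = re_dot dot x (B y).
  by rewrite /re_dot Bsym.
apply/rnorm_eq0/eqP; rewrite -sqrf_eq0; apply/eqP.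
apply: (@linear_term_eq0 _ _ (re_dot dot (B (B f)) (B f))) => [|t].
  exact/scalar_re_ge0/Bpos.
have := scalar_re_ge0 (Bpos (f + of_real k t *: B f)).
(* Symmetry moves [B] off the sum, so the expansion rests on the inner product alone. *)
rewrite -[scalar_re _]/(re_dot dot _ _) rBsym.
rewrite rdotDl rdotZl -!rBsym !rdotDr !rdotZr !rBsym.
rewrite -!(rdotxx norm_dot) [re_dot dot f (B f)]/re_dot -Bsym Bff scalar_re0.
by rewrite (rdotC dot f (B (B f))) rBsym; lra.
Qed.

End PositiveOperator.

(** * Fusion frame sums and the weavings of W with TW *)

Section FusionFrames.
Variables (R : realType) (k : scalar_kind).
Variable H : completeNormedModType (scalars R k).
Variable dot : {dot H for @scalar_conj R k}.
Hypothesis norm_dot : forall x : H, `|x| ^+ 2 = dot x x.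
Variable I : countType.
Implicit Types (x y z f g : H) (V W : I -> set H) (sigma : set I).

Lemma le_esumZ (u v : I -> R) c : 0 <= c -> (forall i, 0 <= v i) ->
    (forall i, u i <= c * v i) ->
  (\esum_(i in [set: I]) (u i)%:E <= c%:E * \esum_(i in [set: I]) (v i)%:E)%E.
Proof.
move=> c0 v0 uv; apply: ge_ereal_sup => _ [F [finF _] <-].
apply: (@le_trans _ _ (\sum_(i \in F) (c%:E * (v i)%:E))%E).
  by apply: lee_fsum => // i _; rewrite -EFinM lee_fin.
rewrite -ge0_mule_fsumr; last by move=> i; rewrite lee_fin.
by apply: lee_wpmul2l; [rewrite lee_fin|apply: esum_ge; exists F].
Qed.

Definition frame_sum W (omega : I -> R) f : \bar R :=
  (\esum_(i in [set: I]) (omega i ^+ 2 * rnorm (proj dot (W i) f) ^+ 2)%:E)%E.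

Lemma le_frame_sum W W' omega f g c : 0 <= c ->
    (forall i, rnorm (proj dot (W i) f) <= c * rnorm (proj dot (W' i) g)) ->
  (frame_sum W omega f <= (c ^+ 2)%:E * frame_sum W' omega g)%E.
Proof.
move=> c0 h; apply: le_esumZ => [|i|i]; first exact: sqr_ge0.
  by rewrite mulr_ge0 ?sqr_ge0.
rewrite [leRHS]mulrCA ler_wpM2l ?sqr_ge0// -exprMn.
rewrite ler_pXn2r ?nnegrE ?rnorm_ge0//.
by rewrite mulr_ge0 ?rnorm_ge0.
Qed.

Variables (W : I -> set H) (omega : I -> R) (CW DW : R).
Hypothesis frameW : fusion_frame dot W omega CW DW.

Let Wc i : closed_subspace (W i). Proof. by case: frameW. Qed.
Let lowerW f : ((CW * rnorm f ^+ 2)%:E <= frame_sum W omega f)%E.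
Proof. by case: frameW => _ _ _ _ /(_ f)/andP[]. Qed.
Let upperW f : (frame_sum W omega f <= (DW * rnorm f ^+ 2)%:E)%E.
Proof. by case: frameW => _ _ _ _ /(_ f)/andP[]. Qed.
Let CW0 : 0 < CW. Proof. by case: frameW. Qed.
Let CDW : CW <= DW. Proof. by case: frameW. Qed.

(** Each weaving is dominated termwise by the sum of both families, so only the lower bound has to
    be uniform in sigma. *)
Lemma woven_of_bounds V (C D : R) : (forall i, closed_subspace (V i)) ->
    0 < C ->
    (forall sigma f,
      ((C * rnorm f ^+ 2)%:E <= frame_sum (weave sigma W V) omega f)%E) ->
    (forall f, (frame_sum V omega f <= (D * rnorm f ^+ 2)%:E)%E) ->
  woven dot W omega V omega.
Proof.
(* Adding C and taking |D| secures C <= C + DW + |D| whatever the sign of D. *)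
move=> Vc C0 lo up; exists C, (C + DW + `|D|) => sigma.
have -> : weave sigma omega omega = omega.
  by apply/funext => i; rewrite /weave if_same.
have [_ omega0 _ _ _] := frameW.
split=> // [i||f].
- by rewrite /weave; case: ifP.
- by rewrite -addrA lerDl addr_ge0// (le_trans _ CDW)// ltW.
rewrite lo /=.
apply: (@le_trans _ _ (frame_sum W omega f + frame_sum V omega f)%E).
  have sum_ge0 U i : (0 <= (omega i ^+ 2 * rnorm (proj dot (U i) f) ^+ 2)%:E)%E.
    by rewrite lee_fin mulr_ge0 ?sqr_ge0.
  rewrite /frame_sum -esumD => [|i _|i _]; rewrite ?sum_ge0//.
  apply: le_esum => i _; rewrite -EFinD lee_fin -mulrDr ler_wpM2l ?sqr_ge0//.
  by rewrite /weave; case: ifP => _; rewrite ?lerDl ?lerDr sqr_ge0.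
apply: le_trans (leeD (upperW f) (up f)) _; rewrite -EFinD lee_fin -mulrDl.
rewrite ler_wpM2r ?sqr_ge0// -addrA addrC -addrA lerD2l.
by rewrite (le_trans (ler_norm D))// lerDl ltW.
Qed.

Variables (T Tinv : {linear H -> H}) (a b : R).
Hypotheses (a0 : 0 < a) (b0 : 0 < b).
Hypotheses (T_le : forall x, rnorm (T x) <= b * rnorm x).
Hypotheses (Tinv_le : forall x, rnorm (Tinv x) <= a * rnorm x).
Hypotheses (TK : cancel T Tinv) (TinvK : cancel Tinv T).

Let T_bounded : bounded_op T. Proof. by exists b. Qed.
Let TW i := T @` W i.
Let TWc i : closed_subspace (TW i).
Proof. exact: (image_closed_subspace a0 Tinv_le TK TinvK). Qed.

Lemma frame_sum_image_le f :
  (frame_sum TW omega f <= ((a ^+ 2 * (DW * b ^+ 2)) * rnorm f ^+ 2)%:E)%E.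
Proof.
apply: le_trans (@le_frame_sum _ _ _ _ (adjoint dot T f) _ (ltW a0) _) _.
  move=> i.
  exact: (rnorm_proj_image_le norm_dot T_bounded a0 Tinv_le TK TinvK).
rewrite -mulrA [in leRHS]EFinM.
apply: lee_wpmul2l; first by rewrite lee_fin sqr_ge0.
apply: le_trans (upperW _) _; rewrite lee_fin -mulrA ler_wpM2l//.
  by rewrite (le_trans _ CDW)// ltW.
rewrite -exprMn ler_pXn2r ?nnegrE ?rnorm_ge0 ?mulr_ge0 ?rnorm_ge0 ?(ltW b0)//.
exact: (rnorm_adjoint_le norm_dot).
Qed.

Lemma woven_image_super :
  (forall i, W i `<=` TW i) -> woven dot W omega TW omega.
Proof.
move=> WTW; apply: (woven_of_bounds TWc CW0 _ frame_sum_image_le) => sigma f.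
apply: le_trans (lowerW f) _.
have := @le_frame_sum W (weave sigma W TW) omega f f 1 ler01.
rewrite expr1n mul1e; apply=> i; rewrite mul1r /weave; case: ifP => // _.
exact: (le_rnorm_proj norm_dot f (Wc i) (TWc i) (WTW i)).
Qed.

Lemma woven_image_sub :
  (forall i, TW i `<=` W i) -> woven dot W omega TW omega.
Proof.
move=> TWW.
(* b^2 times the weaving at f dominates the sum over W at T^* f, hence CW |T^* f|^2; then |f| <= a
   |T^* f| gives this constant. *)
have C0 : 0 < CW / (a ^+ 2 * b ^+ 2) by rewrite divr_gt0// mulr_gt0// exprn_gt0.
apply: (woven_of_bounds TWc C0 _ frame_sum_image_le) => sigma f.
have : ((CW * rnorm (adjoint dot T f) ^+ 2)%:E
    <= (b ^+ 2)%:E * frame_sum (weave sigma W TW) omega f)%E.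
  apply: le_trans (lowerW _) _; apply: (le_frame_sum _ (ltW b0)) => i.
  apply: le_trans (rnorm_proj_adjoint_le norm_dot T_bounded a0 b0 T_le Tinv_le
                     TK TinvK _ (Wc i)) _.
  rewrite ler_pM2l// /weave; case: ifP => // _.
  exact: (le_rnorm_proj norm_dot f (TWc i) (Wc i) (TWW i)).
rewrite -lee_pdivrMl ?exprn_gt0//; apply: le_trans.
rewrite -EFinM lee_fin.
have -> : (b ^+ 2)^-1 * (CW * rnorm (adjoint dot T f) ^+ 2)
    = CW / (a ^+ 2 * b ^+ 2) * (a * rnorm (adjoint dot T f)) ^+ 2.
  by field; rewrite !gt_eqF.
rewrite ler_pM2l// ler_pXn2r ?nnegrE ?mulr_ge0 ?rnorm_ge0 ?(ltW a0)//.
exact: (rnorm_le_adjoint norm_dot T_bounded).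
Qed.

(** Besides bounding I - T^-1, [delta] is the weight that splits the square of a sum, hence its
    strict positivity. *)
Lemma woven_image_adjoint_comp (delta : R) :
    (forall i, W i `<=` [set adjoint dot T (T w) | w in W i]) ->
    0 < delta < CW / DW ->
    (forall f, rnorm (f - Tinv f) <= delta * rnorm f) ->
  woven dot W omega TW omega.
Proof.
move=> WA /andP[d0 dCD] Tinv_near.
have D0 : 0 < DW by exact: lt_le_trans CDW.
have d1 : delta < 1.
  by apply: lt_le_trans dCD _; rewrite ler_pdivrMr// mul1r.
have dC : delta * DW < CW by rewrite -ltr_pdivlMr.
(* Indices in sigma need the factor 1, the others a^2 / (1 - delta); K covers both. *)
pose K := 1 + a ^+ 2 / (1 - delta).
have aK : 0 <= a ^+ 2 / (1 - delta) by rewrite divr_ge0 ?sqr_ge0//; lra.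
have K0 : 0 < K by rewrite /K; lra.
have C0 : 0 < (CW - delta * DW) / K by rewrite divr_gt0// subr_gt0.
apply: (woven_of_bounds TWc C0 _ frame_sum_image_le) => sigma f.
pose U := weave sigma W TW.
have proj_le i : rnorm (proj dot (W i) f) ^+ 2
    <= K * rnorm (proj dot (U i) f) ^+ 2
    + delta^-1 * rnorm (proj dot (W i) (f - Tinv f)) ^+ 2.
  set r := rnorm (proj dot (W i) (f - Tinv f)).
  have r0 : 0 <= delta^-1 * r ^+ 2.
    by rewrite mulr_ge0 ?sqr_ge0 ?invr_ge0 ?(ltW d0).
  rewrite /U /weave; case: ifP => _.
    apply: (@le_trans _ _ (K * rnorm (proj dot (W i) f) ^+ 2)); last by lra.
    by rewrite -[leLHS]mul1r ler_wpM2r ?sqr_ge0// /K; lra.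
  have -> : proj dot (TW i) f = T (proj dot (W i) (Tinv f)).
    exact: (proj_image norm_dot T_bounded a0 Tinv_le TK TinvK).
  have := Tinv_le (T (proj dot (W i) (Tinv f))); rewrite TK.
  have : rnorm (proj dot (W i) f) <= rnorm (proj dot (W i) (Tinv f)) + r.
    rewrite -{1}[f](subrKC (Tinv f)) (projD norm_dot)//; exact: rnormD.
  move: (rnorm_ge0 (proj dot (W i) f)) (rnorm_ge0 (proj dot (W i) (Tinv f))).
  move: (rnorm_ge0 (T (proj dot (W i) (Tinv f)))).
  have : 0 <= r by exact: rnorm_ge0.
  move: (rnorm (T _)) (rnorm (proj dot (W i) f)).
  move: (rnorm (proj dot (W i) (Tinv f))) => s t n rge0 t0 n0 s0 nsr sat.
  have : n ^+ 2 <= (s + r) ^+ 2 by rewrite ler_pXn2r ?nnegrE ?addr_ge0.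
  move/le_trans; apply.
  (* Weighted Young inequality: the defect is a perfect square over delta (1 - delta). *)
  apply: (@le_trans _ _ (s ^+ 2 / (1 - delta) + delta^-1 * r ^+ 2)).
    rewrite -subr_ge0.
    have -> : s ^+ 2 / (1 - delta) + delta^-1 * r ^+ 2 - (s + r) ^+ 2
        = (delta * s - (1 - delta) * r) ^+ 2 / (delta * (1 - delta)).
      by field; rewrite (gt_eqF d0) gt_eqF ?subr_gt0.
    by rewrite divr_ge0 ?sqr_ge0// mulr_ge0 ?subr_ge0 ?(ltW d0) ?(ltW d1).
  rewrite lerD2r.
  apply: (@le_trans _ _ (a ^+ 2 / (1 - delta) * t ^+ 2)).
    rewrite [leRHS]mulrAC -exprMn ler_wpM2r ?invr_ge0 ?subr_ge0 ?(ltW d1)//.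
    by rewrite ler_pXn2r ?nnegrE// mulr_ge0// ltW.
  by rewrite ler_wpM2r ?sqr_ge0// lerDr.
have upper_diff : (frame_sum W omega (f - Tinv f)%R
    <= (DW * (delta ^+ 2 * rnorm f ^+ 2))%:E)%E.
  apply: le_trans (upperW _) _; rewrite lee_fin ler_pM2l// -exprMn.
  by rewrite ler_pXn2r ?nnegrE ?mulr_ge0 ?rnorm_ge0 ?(ltW d0).
(* The errors sum to at most delta^-1 DW delta^2 |f|^2 = delta DW |f|^2, which is absorbed since
   delta DW < CW. *)
have : ((CW * rnorm f ^+ 2)%:E
    <= K%:E * frame_sum U omega f + (delta * DW * rnorm f ^+ 2)%:E)%E.
  apply: le_trans (lowerW f) _.
  have term_ge0 (S : I -> set H) g i :
      0 <= omega i ^+ 2 * rnorm (proj dot (S i) g) ^+ 2.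
    by rewrite mulr_ge0 ?sqr_ge0.
  apply: (@le_trans _ _ (\esum_(i in [set: I])
      ((K * (omega i ^+ 2 * rnorm (proj dot (U i) f) ^+ 2))%:E
       + (delta^-1 * (omega i ^+ 2
           * rnorm (proj dot (W i) (f - Tinv f)%R) ^+ 2))%:E))%E).
    apply: le_esum => i _; rewrite -EFinD lee_fin.
    rewrite 2![_ * (omega i ^+ 2 * _)]mulrCA.
    by rewrite -mulrDr ler_wpM2l ?sqr_ge0.
  rewrite esumD; last 2 first.
  - by move=> i _; rewrite lee_fin mulr_ge0 ?term_ge0 ?(ltW K0).
  - by move=> i _; rewrite lee_fin mulr_ge0 ?term_ge0 ?invr_ge0 ?(ltW d0).
  apply: leeD; first by apply: le_esumZ => //; exact: ltW.
  apply: le_trans (le_esumZ (c := delta^-1) _ _ (fun=> lexx _)) _ => //.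
    by rewrite invr_ge0 ltW.
  apply: le_trans (lee_wpmul2l _ upper_diff) _.
    by rewrite lee_fin invr_ge0 ltW.
  rewrite -EFinM lee_fin le_eqVlt; apply/orP; left; apply/eqP; field.
  by rewrite gt_eqF.
rewrite -leeBlDr// -EFinB -mulrBl -lee_pdivrMl// -EFinM.
by rewrite mulrA [_^-1 * _]mulrC.
Qed.

End FusionFrames.

(** * Single-index frame operators, operator norms, and the three cases *)

Lemma partial_frame_op_set1 (R : realType) (k : scalar_kind)
    (H : completeNormedModType (scalars R k))
    (dot : {dot H for @scalar_conj R k})
    (I : countType) (W : I -> set H) (omega : I -> R) (i : I) (f : H) :
  partial_frame_op dot W omega [set i] f
    = of_real k (omega i ^+ 2) *: proj dot (W i) f.
Proof.
(* The net of finite partial sums is constant from {i} on. *)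
apply: (lim_near_cst (@norm_hausdorff _ H) (FF := totally_filter)).
exists [fset i]%fset => // A /= /fsubsetP iA.
rewrite /partial_sum -(big_seq_fsetE _ A xpredT (fun j =>
  if j \in [set i] then of_real k (omega j ^+ 2) *: proj dot (W j) f else 0)) /=.
rewrite (bigD1_seq i) ?fset_uniq ?iA ?inE//= big1 ?addr0 => [|j /negPf ji].
  by rewrite ifT// inE.
by rewrite ifF//; apply/negbTE/negP; rewrite inE /= => /eqP; rewrite ji.
Qed.

Lemma bounded_op_pos (R : realType) (k : scalar_kind)
    (H : completeNormedModType (scalars R k)) (T : H -> H) :
  bounded_op T -> exists2 M : R, 0 < M & forall x, rnorm (T x) <= M * rnorm x.
Proof.
case=> M MP; exists (`|M| + 1) => [|x]; first by rewrite ltr_wpDl.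
apply: le_trans (MP x) _; rewrite ler_wpM2r ?rnorm_ge0//.
by rewrite (le_trans (ler_norm M))// lerDl.
Qed.

(** Boundedness makes the [sup] an upper bound; a nonzero x is rescaled to norm 1 by a real
    factor. *)
Lemma rnorm_le_opnorm (R : realType) (k : scalar_kind)
    (H : completeNormedModType (scalars R k)) (T : H -> H) :
  bounded_op T ->
  (forall (c : R) x, T (of_real k c *: x) = of_real k c *: T x) ->
  forall x, rnorm (T x) <= opnorm T * rnorm x.
Proof.
move=> /bounded_op_pos[M M0 MP] TZ x.
have [x0|x0] := eqVneq (rnorm x) 0.
  by apply: le_trans (MP x) _; rewrite x0 !mulr0.
have nx : 0 < rnorm x by rewrite lt_neqAle eq_sym x0 rnorm_ge0.
rewrite -ler_pdivrMr// mulrC -[(rnorm x)^-1]ger0_norm ?invr_ge0 ?rnorm_ge0//.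
rewrite -rnormZ -TZ; apply: ub_le_sup.
  exists M => _ [y /= y1 <-]; apply: le_trans (MP y) _.
  by rewrite ler_piMr// ltW.
exists (of_real k (rnorm x)^-1 *: x) => //=.
by rewrite rnormZ ger0_norm ?invr_ge0 ?rnorm_ge0// mulVf.
Qed.

(* In (iii), S_{i} = omega_i^2 P_i and B = T S_{i} - S_{i} T satisfies
   <B f, f> = omega_i^2 <T f - P_i T f, f> = 0 for f in W_i; as B is positive,
   B f = 0, i.e. T f = P_i T f. *)
Lemma image_subset_of_positive_commutator (R : realType) (k : scalar_kind)
    (H : completeNormedModType (scalars R k))
    (dot : {dot H for @scalar_conj R k})
    (norm_dot : forall x : H, `|x| ^+ 2 = dot x x)
    (I : countType) (W : I -> set H) (omega : I -> R) (T : {linear H -> H}) i :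
  closed_subspace (W i) -> 0 < omega i ->
  positive_op dot (fun f => T (partial_frame_op dot W omega [set i] f)
                            - partial_frame_op dot W omega [set i] (T f)) ->
  T @` W i `<=` W i.
Proof.
move=> Wc omega0 /(positive_op_eq0 norm_dot) B0 _ [f Wf <-].
have [Vp pP] := projP norm_dot (T f) Wc.
suff /subr0_eq -> : T f - proj dot (W i) (T f) = 0 by [].
have := B0 f; rewrite !partial_frame_op_set1 (proj_id norm_dot Wc Wf) linearZ.
rewrite -scalerBr dotZl pP// mulr0 => /(_ erefl)/eqP; rewrite scaler_eq0.
case/orP => [|/eqP//].
rewrite -(of_real0 R k) => /eqP/(can_inj (@of_realK R k))/eqP.
by rewrite expf_eq0 gt_eqF.
Qed.

Theorem theorem3p7 (R : realType) (k : scalar_kind)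
    (H : completeNormedModType (scalars R k))
    (dot : {dot H for @scalar_conj R k})
    (norm_dot : forall x : H, `|x| ^+ 2 = dot x x)
    (sepH : separable H)
    (I : countType) (W : I -> set H) (omega : I -> R) (CW DW : R)
    (frameW : fusion_frame dot W omega CW DW)
    (T Tinv : {linear H -> H})
    (T_bounded : bounded_op T) (Tinv_bounded : bounded_op Tinv)
    (TK : cancel T Tinv) (TinvK : cancel Tinv T) :
  let TW := fun i => T @` W i in
  let S := partial_frame_op dot W omega in
  [/\ (forall i, W i `<=` TW i) \/ (forall i, TW i `<=` W i) ->
        woven dot W omega TW omega,
      (forall i, W i `<=` [set adjoint dot T (T w) | w in W i]) ->
        opnorm (fun f => f - Tinv f) < CW / DW ->
        woven dot W omega TW omega
    & unitary dot T ->
        (forall sigma : set I,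
           positive_op dot (fun f => T (S sigma f) - S sigma (T f))) ->
        woven dot W omega TW omega].
Proof.
move=> TW S.
have [b b0 T_le] := bounded_op_pos T_bounded.
have [a a0 Tinv_le] := bounded_op_pos Tinv_bounded.
have woven_sub := woven_image_sub norm_dot frameW a0 b0 T_le Tinv_le TK TinvK.
have [Wc omega0 CW0 CDW _] := frameW.
split=> [[|]||_ S_comm].
- exact: (woven_image_super norm_dot frameW a0 b0 T_le Tinv_le TK TinvK).
- exact: woven_sub.
- move=> WA near.
  pose E f := f - Tinv f.
  have E_bounded : bounded_op E.
    exists (1 + a) => f; rewrite mulrDl mul1r.
    apply: le_trans (rnormD _ _) _; rewrite lerD2l.
    by rewrite -[- _]add0r -rnormB subr0.
  have EZ (c : R) x : E (of_real k c *: x) = of_real k c *: E x.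
    by rewrite /E linearZ scalerBr.
  have E_le := rnorm_le_opnorm E_bounded EZ.
  (* The maximum with 0 makes the midpoint of m and CW / DW strictly positive, as [delta] must be;
     it still lies above the operator norm and below CW / DW. *)
  pose m := Num.max (opnorm E) 0.
  have mCD : m < CW / DW.
    by rewrite gt_max near divr_gt0// (lt_le_trans CW0).
  have m0 : 0 <= m by rewrite le_max lexx orbT.
  apply: (@woven_image_adjoint_comp _ _ _ _ norm_dot _ _ _ _ _ frameW _ _ _ _
    a0 b0 T_le Tinv_le TK TinvK ((m + CW / DW) / 2)) => // [|f].
    by apply/andP; split; lra.
  apply: le_trans (E_le f) _; rewrite ler_wpM2r ?rnorm_ge0//.
  have Em : opnorm E <= m by rewrite le_max lexx.
  by lra.
- by apply: woven_sub => i; apply: (image_subset_of_positive_commutator norm_dot).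
Qed.
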